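(* Let $\mathcal{X}$ be a real Banach space and let $\mathcal{F}\subset\mathcal{X}$ be a compact set contained in the closed unit ball of $\mathcal{X}$ whose linear span is infinite dimensional. Let $\{f_n\}_{n\ge0}$, $\{g_n\}_{n\ge0}$, $\{V_n\}_{n\ge0}$ be any realization of the Natural Greedy Algorithm for $\mathcal{F}$, and let $\sigma_n(\mathcal{F},\mathcal{X})=\sup_{f\in\mathcal{F}}\operatorname{dist}(f,V_n)$. Then for every integer $n\ge0$ $$\sigma_n(\mathcal{F},\mathcal{X})\le B^g_{n+1}(\mathcal{F},\mathcal{X})\,\gamma_{2n+1}(\mathcal{X})\,2^{n+1}\,d_n(\mathcal{F},\mathcal{X}).$$
   Context: Norming functionals: for $x\in\mathcal{X}\setminus\{0\}$, a norming functional $F_x\in\mathcal{X}^*$ satisfies $\|F_x\|_{\mathcal{X}^*}=1$ and $F_x(x)=\|x\|$ (if it is not unique, any choice is allowed, fixed once for each $g_n$). Natural Greedy Algorithm (NGA): Set $\mathcal{R}_0(f)=f$ and $V_0=\{0\}$. For $n=0,1,2,\dots$: choose $f_n\in\mathcal{F}$ with $\|\mathcal{R}_n(f_n)\|=\max_{f\in\mathcal{F}}\|\mathcal{R}_n(f)\|$; put $g_n=\mathcal{R}_n(f_n)/\|\mathcal{R}_n(f_n)\|$; choose a norming functional $F_{g_n}$; put $r_n(f)=f-F_{g_n}(f)\,g_n$, $\mathcal{R}_{n+1}=r_n\circ\mathcal{R}_n=r_n\circ r_{n-1}\circ\dots\circ r_0$, and $V_{n+1}=\operatorname{span}\{f_0,\dots,f_n\}=\operatorname{span}\{g_0,\dots,g_n\}$.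 Any sequences produced by such choices form a realization. $\operatorname{dist}(f,V)=\inf_{v\in V}\|f-v\|$. Kolmogorov width: $d_n(\mathcal{F},\mathcal{X})=\inf_{X_n}\sup_{f\in\mathcal{F}}\operatorname{dist}(f,X_n)$, the infimum over $n$-dimensional subspaces $X_n\subset\mathcal{X}$. $\gamma_n(\mathcal{X})=\sup\{d(V,\ell_2^n): V\subset\mathcal{X},\ \dim V=n\}$, where $d(V,W)=\inf\{\|T\|\,\|T^{-1}\|: T:V\to W \text{ linear isomorphism}\}$ is the multiplicative Banach–Mazur distance. Modulus of smoothness: $\rho(u)=\sup_{\|x\|=\|y\|=1}\frac{\|x+uy\|+\|x-uy\|}{2}-1$. $R(\mathcal{X})=1+\mu$, where $\mu\in(0,1]$ is such that $1+\mu=2\mu\,\rho(\mu^{-1})$. $C_g=C_g(\mathcal{F},\mathcal{X})\in[1,\infty]$ is the basis constant of $\{g_n\}_{n\ge0}$: the supremum over $n\ge1$ of the operator norms of the partial sum projections $\sum_k\alpha_kg_k\mapsto\sum_{k<n}\alpha_kg_k$ on the linear span of $\{g_k\}_{k\ge0}$. $B^g_s(\mathcal{F},\mathcal{X})=\min\{R(\mathcal{X})^s,\ C_g(\mathcal{F},\mathcal{X})+1\}$ for $s\ge0$. *)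

(* Defs.v *)
From HB Require Import structures.
From mathcomp Require Import all_boot all_order all_algebra.
From mathcomp Require Import all_classical all_reals all_analysis.
Import Order.TTheory GRing.Theory Num.Theory.
Import numFieldNormedType.Exports.

Set Implicit Arguments.
Unset Strict Implicit.
Unset Printing Implicit Defensive.

Local Open Scope classical_set_scope.
Local Open Scope ring_scope.

(* Suprema and infima that are not evidently finite are taken in [\bar R]; only
   the modulus of smoothness, which is bounded by |u|, uses the real [sup]. *)

Section linear_subspaces.
Context {R : realType}.

Definition lspan {U : lmodType R} (A : set U) : set U :=
  [set x | exists (n : nat) (a : 'I_n -> R) (v : 'I_n -> U),
     (forall i, A (v i)) /\ x = \sum_(i < n) a i *: v i].

Definition lin_indep {U : lmodType R} (n : nat) (b : 'I_n -> U) : Prop :=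
  forall a : 'I_n -> R, \sum_(i < n) a i *: b i = 0 -> forall i, a i = 0.

Definition has_dim {U : lmodType R} (V : set U) (n : nat) : Prop :=
  exists b : 'I_n -> U, lin_indep b /\ V = lspan (range b).

Definition finite_dim {U : lmodType R} (V : set U) : Prop :=
  exists n, has_dim V n.

Definition linear_on {U W : lmodType R} (V : set U) (T : U -> W) : Prop :=
  forall (a : R) x y, V x -> V y -> T (a *: x + y) = a *: T x + T y.

(* Only the values of [T] on [V] matter; the norms are explicit arguments
   because 'rV[R]_n carries the sup norm, not the Euclidean one. *)
Definition opnorm {U W : lmodType R} (NU : U -> R) (NW : W -> R)
    (V : set U) (T : U -> W) : \bar R :=
  ereal_sup [set (NW (T x))%:E | x in [set x | V x /\ NU x <= 1]].

Definition is_iso {U W : lmodType R} (V : set U) (V' : set W)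
    (T : U -> W) (S : W -> U) : Prop :=
  [/\ linear_on V T,
      (forall x, V x -> V' (T x)), (forall y, V' y -> V (S y)),
      (forall x, V x -> S (T x) = x) & (forall y, V' y -> T (S y) = y)].

Definition banach_mazur {U W : lmodType R} (NU : U -> R) (NW : W -> R)
    (V : set U) (V' : set W) : \bar R :=
  ereal_inf [set c | exists (T : U -> W) (S : W -> U), is_iso V V' T S /\
     c = (opnorm NU NW V T * opnorm NW NU V' S)%E].

Definition l2norm (n : nat) (x : 'rV[R]_n) : R :=
  Num.sqrt (\sum_(i < n) x ord0 i ^+ 2).

End linear_subspaces.

Section banach_space.
Context {R : realType} (X : normedModType R).

Definition dist (x : X) (V : set X) : \bar R :=
  ereal_inf [set `|x - v|%:E | v in V].

Definition sup_dist (F V : set X) : \bar R := ereal_sup [set dist x V | x in F].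

Definition kolmogorov_width (F : set X) (n : nat) : \bar R :=
  ereal_inf [set sup_dist F V | V in [set V : set X | has_dim V n]].

Definition gamma (n : nat) : \bar R :=
  ereal_sup [set banach_mazur (fun x : X => `|x|) (@l2norm R n) V setT |
             V in [set V : set X | has_dim V n]].

Definition smoothness (u : R) : R :=
  sup [set r | exists x y : X, [/\ `|x| = 1, `|y| = 1 &
         r = (`|x + u *: y| + `|x - u *: y|) / 2 - 1]].

Definition is_mu (mu : R) : Prop :=
  0 < mu <= 1 /\ 1 + mu = 2 * mu * smoothness mu^-1.

(* For X <> 0 there is exactly one such mu: with u = mu^-1 the equation reads
   smoothness u = (u + 1) / 2, where [smoothness] is convex, vanishes at 0,
   is at most 1 at u = 1 and is at least u - 1 for all u. *)
Definition Rconst : R := 1 + xget 0 [set mu | is_mu mu].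

Definition norming_functional (x : X) (phi : {scalar X}) : Prop :=
  opnorm (fun y : X => `|y|) (fun t : R^o => `|t|) setT phi = 1%E /\
  phi x = `|x|.

Fixpoint residual (g : nat -> X) (phi : nat -> {scalar X}) (n : nat) (x : X)
    : X :=
  if n is m.+1 then
    let y := residual g phi m x in y - phi m y *: g m
  else x.

Definition NGA_realization (F : set X) (f g : nat -> X)
    (phi : nat -> {scalar X}) : Prop :=
  forall n,
    [/\ F (f n),
        (forall h, F h -> `|residual g phi n h| <= `|residual g phi n (f n)|),
        g n = `|residual g phi n (f n)|^-1 *: residual g phi n (f n) &
        norming_functional (g n) (phi n)].

Definition greedy_space (f : nat -> X) (n : nat) : set X :=
  lspan [set f k | k in [set k | (k < n)%N]].

Definition greedy_sigma (F : set X) (f : nat -> X) (n : nat) : \bar R :=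
  sup_dist F (greedy_space f n).

(* Quantifying over coefficients is legitimate because the [g k] produced by
   the algorithm are linearly independent when F spans an infinite dimensional
   space. *)
Definition partial_sum_norm (g : nat -> X) (n : nat) : \bar R :=
  ereal_sup [set c | exists (N : nat) (a : nat -> R),
     `|\sum_(k < N) a k *: g k| <= 1 /\
     c = `|\sum_(k < N | (k < n)%N) a k *: g k|%:E].

Definition basis_constant (g : nat -> X) : \bar R :=
  ereal_sup [set partial_sum_norm g n | n in [set n | (0 < n)%N]].

Definition Bg (g : nat -> X) (s : R) : \bar R :=
  Order.min (Rconst `^ s)%:E (basis_constant g + 1)%E.

End banach_space.

(* Main.v *)
(* The residual operators annihilate the earlier [g k] and fix the later ones,
   so on combinations [w] of the [g k] the coefficient of [g j] has absolute
   value at most [|R_j w| <= B |w|]. If a space [W] of dimension [n]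
   approximates F within [e], then [s j *: g j], with [s j = |R_j (f j)|], has an
   approximant [u j] in [W] within [2 ^ j * e], by forward substitution. The
   vectors [u 0], ..., [u n] of [W] satisfy a nontrivial relation with
   coefficients [a j]. For [w = \sum_j a j *: (s j *: g j)] this gives
   [|w| <= \sum_j |a j| * 2 ^ j * e], while [|a j| * s j <= B |w|], so that
   [s j <= B * 2 ^ n.+1 * e] for some [j <= n]. Finally every [s j] with
   [j <= n] bounds the distance from F to [V_n], since [V_j] is contained in
   [V_n]. No Euclidean structure is involved, and of the factor gamma only
   [1 <= gamma] matters. *)
Require Import Defs.
From HB Require Import structures.
From mathcomp Require Import all_boot all_order all_algebra.
From mathcomp Require Import all_classical all_reals all_analysis.
From mathcomp Require Import ring lra.
Import Order.TTheory GRing.Theory Num.Theory.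
Import numFieldNormedType.Exports.

Set Implicit Arguments.
Unset Strict Implicit.
Unset Printing Implicit Defensive.

Local Open Scope classical_set_scope.
Local Open Scope ring_scope.

(** * Subspaces, spans and linear dependence *)

Section linear_span.
Context {R : realType} {U : lmodType R}.
Implicit Types (A W : set U).

Definition subspace W : Prop :=
  W 0 /\ forall (a : R) x y, W x -> W y -> W (a *: x + y).

Lemma subspaceD W x y : subspace W -> W x -> W y -> W (x + y).
Proof. by move=> [_ WD] Wx Wy; rewrite -[x]scale1r; exact: WD. Qed.

Lemma subspaceZ W (a : R) x : subspace W -> W x -> W (a *: x).
Proof. by move=> [W0 WD] Wx; rewrite -[a *: x]addr0; exact: WD. Qed.

Lemma subspaceB W x y : subspace W -> W x -> W y -> W (x - y).
Proof.
by move=> sW Wx Wy; rewrite -scaleN1r; apply: subspaceD => //; exact: subspaceZ.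
Qed.

Lemma subspace_sum W n (a : 'I_n -> R) (v : 'I_n -> U) :
  subspace W -> (forall i, W (v i)) -> W (\sum_(i < n) a i *: v i).
Proof.
move=> sW Wv; elim/big_ind : _ => [|x y|i _].
- by case: sW.
- exact: subspaceD.
- exact: subspaceZ.
Qed.

Lemma lspan_subset A W : subspace W -> A `<=` W -> lspan A `<=` W.
Proof.
by move=> sW AW x [n [a [v [Av ->]]]]; apply: subspace_sum => // i; exact/AW.
Qed.

Lemma subset_lspan A : A `<=` lspan A.
Proof.
by move=> x Ax; exists 1%N, (fun=> 1), (fun=> x); rewrite big_ord1 scale1r.
Qed.

Lemma lspan_subspace A : subspace (lspan A).
Proof.
split=> [|c x y [n [a [v [Av ->]]]] [m [b [w [Aw ->]]]]].
  by exists 0%N, (fun=> 0), (fun=> 0); rewrite big_ord0; split=> // -[].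
exists (n + m)%N,
  (fun k : 'I_(n + m) =>
     match fintype.split k with inl i => c * a i | inr j => b j end),
  (fun k : 'I_(n + m) =>
     match fintype.split k with inl i => v i | inr j => w j end); split.
  by move=> k; case: (fintype.split k).
rewrite big_split_ord scaler_sumr; congr (_ + _); apply: eq_bigr => i _.
  by rewrite (unsplitK (inl i)) scalerA.
by rewrite (unsplitK (inr i)).
Qed.

Lemma lspan_range n (b : 'I_n -> U) x :
  lspan (range b) x -> exists c : 'I_n -> R, x = \sum_(i < n) c i *: b i.
Proof.
have sub : subspace [set y | exists c : 'I_n -> R, y = \sum_(i < n) c i *: b i].
  split=> [|a _ _ [c ->] [d ->]].
    by exists (fun=> 0); rewrite big1 // => i _; rewrite scale0r.
  exists (fun i => a * c i + d i); rewrite scaler_sumr -big_split.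
  by apply: eq_bigr => i _; rewrite /= scalerDl scalerA.
apply: (lspan_subset sub) => _ [i _ <-]; exists (fun j => (j == i)%:R).
rewrite (bigD1 i) //= eqxx scale1r big1 ?addr0 // => j /negPf ->.
by rewrite scale0r.
Qed.

Lemma has_dim_subspace W n : has_dim W n -> subspace W.
Proof. by move=> [b [_ ->]]; exact: lspan_subspace. Qed.

(** The coordinates of the [u j] form a matrix with one more row than columns, so its left kernel
    contains a nonzero row. *)
Lemma has_dim_dependent W n (u : nat -> U) :
  has_dim W n -> (forall j, (j <= n)%N -> W (u j)) ->
  exists a : nat -> R,
    (exists2 j, (j <= n)%N & a j != 0) /\ \sum_(j < n.+1) a j *: u j = 0.
Proof.
move=> [b [_ ->]] Wu.
have /choice[c cE] (j : 'I_n.+1) : exists c : 'I_n -> R, u j = \sum_(i < n) c i *: b i.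
  by apply: lspan_range; apply: Wu; rewrite -ltnS.
pose M : 'M[R]_(n.+1, n) := \matrix_(j, i) c j i.
have /rowV0Pn[a aM a0] : kermx M != 0.
  by rewrite -mxrank_eq0 mxrank_ker subn_eq0 -ltnNge ltnS rank_leq_col.
exists (fun j => a ord0 (inord j)); split.
  have /rV0Pn[j aj] := a0.
  by exists j; [rewrite -ltnS|rewrite inord_val].
have {}aM : a *m M = 0 by exact/sub_kermxP.
under eq_bigr do rewrite cE scaler_sumr inord_val.
rewrite exchange_big big1 // => i _.
under eq_bigr do rewrite scalerA.
rewrite -scaler_suml; have := congr1 (fun N : 'rV_n => N ord0 i) aM.
rewrite !mxE; under eq_bigr do rewrite mxE.
by move=> ->; rewrite scale0r.
Qed.

End linear_span.

(** * Modulus of smoothness and the norm of one greedy step *)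

Section smoothness.
Context {R : realType} {X : normedModType R} {e : X} (e1 : `|e| = 1).

Let smoothness_ubound (u : R) : ubound [set r | exists x y : X, [/\ `|x| = 1, `|y| = 1 &
  r = (`|x + u *: y| + `|x - u *: y|) / 2 - 1]] `|u|.
Proof.
move=> _ [x [y [x1 y1 ->]]].
have := ler_normD x (u *: y); have := ler_normB x (u *: y).
rewrite normrZ x1 y1 mulr1; lra.
Qed.

Lemma le_smoothness (u : R) (x y : X) : `|x| = 1 -> `|y| = 1 ->
  `|x + u *: y| + `|x - u *: y| <= 2 + 2 * smoothness X u.
Proof.
move=> x1 y1.
suff : (`|x + u *: y| + `|x - u *: y|) / 2 - 1 <= smoothness X u by lra.
by apply: ub_le_sup; [exists `|u|; exact: smoothness_ubound|exists x, y].
Qed.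

Lemma smoothness_le (u c : R) :
  (forall x y : X, `|x| = 1 -> `|y| = 1 ->
     `|x + u *: y| + `|x - u *: y| <= 2 + 2 * c) ->
  smoothness X u <= c.
Proof.
move=> h; apply: ge_sup; first by do 3 eexists; split; [exact: e1|exact: e1|].
by move=> _ [x [y [x1 y1 ->]]]; have := h x y x1 y1; lra.
Qed.

(** Replacing [u] by [v] moves each of the two vectors [x + u *: y] and [x - u *: y] by [|u - v|] in
    norm. The resulting continuity serves the intermediate value theorem. *)
Lemma smoothness_lipschitz (u v : R) :
  `|smoothness X u - smoothness X v| <= `|u - v|.
Proof.
have one_sided (s t : R) : smoothness X s <= smoothness X t + `|s - t|.
  apply: smoothness_le => x y x1 y1; have := le_smoothness t x1 y1.
  have -> : x + s *: y = (x + t *: y) + (s - t) *: y.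
    by rewrite -addrA -scalerDl [t + _]addrC subrK.
  have -> : x - s *: y = (x - t *: y) - (s - t) *: y.
    by rewrite -addrA -opprD -scalerDl [t + _]addrC subrK.
  have := ler_normD (x + t *: y) ((s - t) *: y).
  have := ler_normB (x - t *: y) ((s - t) *: y).
  rewrite normrZ y1 mulr1; lra.
rewrite ler_distl; have := one_sided u v; have := one_sided v u.
rewrite [`|v - u|]distrC; lra.
Qed.

Lemma smoothness_continuous : continuous (smoothness X).
Proof.
move=> u; apply/cvgrPdist_lt => d d0; near=> v.
by apply: le_lt_trans (smoothness_lipschitz u v) _; near: v; exact: cvgr_dist_lt.
Unshelve. all: by end_near. Qed.

(** With [u = mu^-1] the equation becomes [h u = 0], and [h] changes sign on [1, 3]. A root [u >= 1]
    gives [mu <= 1]. *)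
Lemma exists_mu : exists mu : R, is_mu X mu.
Proof.
pose h (u : R) := smoothness X u - (u + 1) / 2.
have h1 : h 1 <= 0.
  suff : smoothness X 1 <= 1 by rewrite /h; lra.
  apply: smoothness_le => x y x1 y1.
  have := ler_normD x (1 *: y); have := ler_normB x (1 *: y).
  rewrite normrZ x1 y1 normr1; lra.
(* Taking [x = y = e] gives smoothness at least [u - 1], which reaches [(u + 1) / 2] exactly at
   [u = 3]. *)
have h3 : 0 <= h 3.
  suff : 2 <= smoothness X 3 by rewrite /h; lra.
  have := le_smoothness 3 e1 e1.
  have -> : e + 3 *: e = 4 *: e.
    by rewrite -{1}[e]scale1r -scalerDl; congr (_ *: _); lra.
  have -> : e - 3 *: e = - 2 *: e.
    by rewrite -{1}[e]scale1r -scalerBl; congr (_ *: _); lra.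
  rewrite !normrZ e1 normrN !ger0_norm; lra.
have [||| u u13 hu] := @IVT R h 1 3 0.
- lra.
- apply: continuous_subspaceT => u; apply: cvgB; first exact: smoothness_continuous.
  by apply: cvgM; [apply: cvgD; [exact: cvg_id|exact: cvg_cst]|exact: cvg_cst].
- by rewrite ge_min le_max h1 h3 orbT.
have /andP[u1 _] : 1 <= u <= 3 by move: u13; rewrite in_itv.
have u0 : 0 < u by lra.
exists u^-1; split.
  by rewrite invr_gt0 u0 invf_le1.
rewrite invrK; have -> : smoothness X u = (u + 1) / 2 by rewrite /h in hu; lra.
by field; lra.
Qed.

(** Existence of [mu] rules out the default value 0 of [xget]. *)
Lemma Rconst_mu : is_mu X (Rconst X - 1).
Proof.
rewrite /Rconst addrAC subrr add0r.
exact: (@xgetPex _ 0 [set mu | is_mu X mu] exists_mu).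
Qed.

Lemma Rconst_ge1 : 1 <= Rconst X.
Proof. by have [/andP[+ _] _] := Rconst_mu; lra. Qed.

Lemma norming_functional_le (g : X) (phi : {scalar X}) (x : X) :
  norming_functional g phi -> `|phi x| <= `|x|.
Proof.
move=> [phi1 _].
have [->|x0] := eqVneq x 0; first by rewrite linear0 !normr0.
have nx : 0 < `|x| by rewrite normr_gt0.
have : `|phi (`|x|^-1 *: x)| <= 1.
  rewrite -lee_fin -phi1; apply: ereal_sup_ubound; exists (`|x|^-1 *: x) => //=.
  by split=> //; rewrite normrZ normfV normr_id mulVf ?gt_eqF.
by rewrite scalarZ normrM normfV normr_id mulrC ler_pdivrMr // mul1r.
Qed.

(* With [t = phi x >= 0] and [|x| = 1]: for [t <= mu] the triangle inequality
   suffices; otherwise [|g + x / mu| >= 1 + t / mu] and the definition of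
   [mu] bound [|g - x / mu|]. *)
Lemma greedy_step_le (g : X) (phi : {scalar X}) (x : X) :
  `|g| = 1 -> norming_functional g phi ->
  `|x - phi x *: g| <= Rconst X * `|x|.
Proof.
move=> g1 phiP; have phig : phi g = 1 by case: phiP; rewrite g1.
have phi_le := norming_functional_le _ phiP.
have [/andP[mu0 mu1]] := Rconst_mu; set mu := Rconst X - 1 in mu0 mu1 *.
have -> : Rconst X = 1 + mu by rewrite /mu; lra.
move=> muE.
have unit_case (y : X) : `|y| = 1 -> 0 <= phi y -> `|y - phi y *: g| <= 1 + mu.
  move=> y1 t0; set t := phi y in t0 *.
  have tri : `|y - t *: g| <= 1 + t.
    by have := ler_normB y (t *: g); rewrite normrZ y1 g1 mulr1 ger0_norm.
  have [tmu|mut] := leP t mu; first by lra.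
  have lower : 1 + mu^-1 * t <= `|g + mu^-1 *: y|.
    have := phi_le (g + mu^-1 *: y); rewrite linearD scalarZ phig.
    by apply: le_trans; exact: ler_norm.
  have upper := le_smoothness mu^-1 g1 y1.
  have bound : `|g - mu^-1 *: y| <= 2 + 2 * smoothness X mu^-1 - (1 + mu^-1 * t).
    by move: lower upper; lra.
  have : mu * `|g - mu^-1 *: y| <= mu * (2 + 2 * smoothness X mu^-1 - (1 + mu^-1 * t)).
    by rewrite ler_pM2l.
  have -> : mu * `|g - mu^-1 *: y| = `|y - mu *: g|.
    rewrite -[X in X * _]gtr0_norm // -normrZ scalerBr scalerA mulfV ?gt_eqF //.
    by rewrite scale1r distrC.
  (* The defining equation of [mu] eliminates the smoothness term. *)
  have -> : mu * (2 + 2 * smoothness X mu^-1 - (1 + mu^-1 * t)) = 1 + 2 * mu - t.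
    have -> : mu * (2 + 2 * smoothness X mu^-1 - (1 + mu^-1 * t)) =
        mu + 2 * mu * smoothness X mu^-1 - t by field; rewrite gt_eqF.
    by rewrite -muE; ring.
  (* The two pieces have norms at most [1 + 2 * mu - t] and [t - mu], whose sum [1 + mu] is free of
     [t]. *)
  have -> : y - t *: g = (y - mu *: g) - (t - mu) *: g.
    by rewrite -addrA -opprD -scalerDl [mu + _]addrC subrK.
  have := ler_normB (y - mu *: g) ((t - mu) *: g).
  by rewrite normrZ g1 mulr1 gtr0_norm ?subr_gt0 //; lra.
have norm_case (y : X) : `|y| = 1 -> `|y - phi y *: g| <= 1 + mu.
  move=> y1; have [/unit_case|/ltW ty] := leP 0 (phi y); first exact.
  have := unit_case (- y); rewrite normrN linearN oppr_ge0 => /(_ y1 ty).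
  by rewrite scaleNr -opprD normrN.
have [->|x0] := eqVneq x 0; first by rewrite linear0 scale0r subr0 normr0 mulr0.
have nx : 0 < `|x| by rewrite normr_gt0.
have := norm_case (`|x|^-1 *: x); rewrite normrZ normfV normr_id mulVf ?gt_eqF //.
move=> /(_ erefl); rewrite scalarZ -scalerA -scalerBr normrZ normfV normr_id.
by rewrite mulrC ler_pdivrMr.
Qed.

End smoothness.

(** * Algebra and growth of the residual operators *)

Section residuals.
Context {R : realType} {X : normedModType R} {g : nat -> X}.
Context {phi : nat -> {scalar X}}.
Local Notation res := (residual g phi).

Lemma residual_sum n x :
  res n x = x - \sum_(j < n) phi j (res j x) *: g j.
Proof.
elim: n => [|n IHn]; first by rewrite big_ord0 subr0.
by rewrite big_ord_recr /= {1}IHn opprD addrA.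
Qed.

Lemma residual_linear n (a : R) x y : res n (a *: x + y) = a *: res n x + res n y.
Proof.
elim: n => [//|n IHn] /=; rewrite IHn linearD scalarZ.
by rewrite scalerDl -scalerA scalerBr opprD addrACA.
Qed.

Lemma residual0 n : res n 0 = 0.
Proof.
by have := residual_linear n (- 1) 0 0; rewrite scaler0 addr0 scaleN1r addNr.
Qed.

Lemma residual_lincomb n N (a : 'I_N -> R) (v : 'I_N -> X) :
  res n (\sum_(i < N) a i *: v i) = \sum_(i < N) a i *: res n (v i).
Proof.
elim/big_rec2 : _ => [|i y x _ <-]; first exact: residual0.
exact: residual_linear.
Qed.

Lemma residual_le n x : (forall k, `|g k| = 1) ->
  (forall k, norming_functional (g k) (phi k)) ->
  `|res n x| <= Rconst X ^+ n * `|x|.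
Proof.
move=> g1 phiP; elim: n => [|n IHn] /=; first by rewrite mul1r.
apply: le_trans (greedy_step_le (g1 0%N) _ (g1 n) (phiP n)) _.
rewrite exprS -mulrA ler_wpM2l //.
by apply: le_trans (Rconst_ge1 (g1 0%N)).
Qed.

End residuals.

(** * Triangular structure of the greedy system and decay of the residuals *)

Section natural_greedy_algorithm.
Context {R : realType} {X : normedModType R} {F : set X} {f g : nat -> X}.
Context {phi : nat -> {scalar X}}.
Hypothesis fgP : NGA_realization F f g phi.
Local Notation res := (residual g phi).

Lemma greedy_norming k : res k (f k) != 0 -> `|g k| = 1 /\ phi k (g k) = 1.
Proof.
move=> r0; have [_ _ gE [_ ->]] := fgP k.
by rewrite gE normrZ normfV normr_id mulVf ?normr_eq0.
Qed.

(** Step [j] removes the value of [phi j], and later steps subtract multiples of [g m], itself a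
    multiple of a residual already killed by [phi j]. The assumption is made per index because
    [residual_neq0] uses this inside an induction, before all the [g k] are known to be nonzero. *)
Lemma phi_residual j m x : phi j (g j) = 1 -> (j < m)%N -> phi j (res m x) = 0.
Proof.
move=> phi1; elim: m x => [//|m IHm] x /=.
rewrite ltnS leq_eqVlt linearB scalarZ => /predU1P[<-|jm].
  by rewrite phi1 mulr1 subrr.
by have [_ _ -> _] := fgP m; rewrite scalarZ !IHm // !mulr0 subr0.
Qed.

Lemma phi_greedy_lt j m : phi j (g j) = 1 -> (j < m)%N -> phi j (g m) = 0.
Proof.
by move=> phi1 jm; have [_ _ -> _] := fgP m; rewrite scalarZ phi_residual // mulr0.
Qed.

Lemma residual_greedy_ge j m :
  (forall k, (k < j)%N -> phi k (g k) = 1) -> (j <= m)%N -> res j (g m) = g m.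
Proof.
move=> phi1; elim: j phi1 => [//|j IHj] phi1 jm /=.
rewrite IHj ?(ltnW jm)// => [|k kj]; last by apply: phi1; exact: ltnW.
by rewrite phi_greedy_lt ?phi1 // scale0r subr0.
Qed.

Lemma residual_greedy_lt j m :
  (forall k, (k < j)%N -> phi k (g k) = 1) -> (m < j)%N -> res j (g m) = 0.
Proof.
elim: j => [//|j IHj] phi1; rewrite ltnS leq_eqVlt => /predU1P[->|mj] /=.
  rewrite residual_greedy_ge // => [|k kj]; last by apply: phi1; exact: ltnW.
  by rewrite phi1 // scale1r subrr.
rewrite IHj // => [|k kj]; last by apply: phi1; exact: ltnW.
by rewrite linear0 scale0r subr0.
Qed.

(** [res j] kills [g i] for [i < j] and fixes the others, of which [phi j] kills all but [g j]. This
    yields linear independence and a norm bound on coefficients. *)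
Lemma greedy_coef N (a : 'I_N -> R) (j : 'I_N) :
  (forall k, (k < N)%N -> phi k (g k) = 1) ->
  phi j (res j (\sum_(i < N) a i *: g i)) = a j.
Proof.
move=> phi1; have phi1' k : (k < j)%N -> phi k (g k) = 1.
  by move=> kj; apply: phi1; exact: ltn_trans (ltn_ord j).
rewrite residual_lincomb linear_sum (bigD1 j) //= big1 => [|i ij].
  by rewrite addr0 scalarZ residual_greedy_ge // phi1 // mulr1.
rewrite scalarZ; have [lij|lji|/val_inj eij] := ltngtP i j.
- by rewrite residual_greedy_lt // linear0 mulr0.
- by rewrite residual_greedy_ge ?(ltnW lji) // phi_greedy_lt ?phi1 // mulr0.
- by rewrite eij eqxx in ij.
Qed.

Lemma greedy_mem (W : set X) n : subspace W ->
  (forall k, (k < n)%N -> W (f k)) -> forall k, (k < n)%N -> W (g k).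
Proof.
move=> sW Wf; elim/ltn_ind => k IHk kn.
have [_ _ -> _] := fgP k; apply: subspaceZ => //; rewrite residual_sum.
apply: subspaceB => //; first exact: Wf.
by apply: subspace_sum => // i; apply: IHk => //; exact: ltn_trans kn.
Qed.

(** At a first vanishing maximal residual, maximality makes [res n] vanish on all of [F]. Then [F]
    lies in the span of the independent vectors [g 0, ..., g (n - 1)], which is finite
    dimensional. *)
Lemma residual_neq0 n : ~ finite_dim (lspan F) -> res n (f n) != 0.
Proof.
move=> infdim; elim/ltn_ind : n => n IHn; apply/eqP => rn0; apply: infdim.
have phi1 k (kn : (k < n)%N) : phi k (g k) = 1 := (greedy_norming (IHn k kn)).2.
exists n, (fun i : 'I_n => g i); split=> [a a0 i|].
  by rewrite -(greedy_coef a i phi1) a0 residual0 linear0.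
apply/seteqP; split; apply: lspan_subset (lspan_subspace _) _.
  move=> x Fx; have : res n x = 0.
    by have [_ /(_ x Fx) + _ _] := fgP n; rewrite rn0 normr0 normr_le0 => /eqP.
  rewrite residual_sum => /eqP; rewrite subr_eq0 => /eqP ->.
  by apply: subspace_sum (lspan_subspace _) _ => i; apply: subset_lspan; exists i.
move=> _ [i _ <-]; apply: (greedy_mem (n := n)) (ltn_ord i).
  exact: lspan_subspace.
by move=> k _; apply: subset_lspan; have [] := fgP k.
Qed.

(** The difference [x - res j x] is a combination of the [g i] with [i < j], so it lies in the
    greedy space. *)
Lemma dist_greedy_space_le n j x :
  (j <= n)%N -> (dist x (greedy_space f n) <= `|res j x|%:E)%E.
Proof.
move=> jn; apply: ereal_inf_lbound.
exists (\sum_(i < j) phi i (res i x) *: g i); last by rewrite -residual_sum.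
apply: subspace_sum (lspan_subspace _) _ => i.
apply: (greedy_mem (n := n)) => [|k kn|].
- exact: lspan_subspace.
- by apply: subset_lspan; exists k.
- exact: leq_trans jn.
Qed.

Lemma sum_pow2 k : \sum_(j < k) 2 ^+ j = 2 ^+ k - 1 :> R.
Proof.
elim: k => [|k IHk]; first by rewrite big_ord0 expr0 subrr.
by rewrite big_ord_recr /= IHk exprS; ring.
Qed.

Hypothesis infdim : ~ finite_dim (lspan F).

Let g1 k : `|g k| = 1.
Proof. by have [] := greedy_norming (residual_neq0 k infdim). Qed.

Let phi1 k : phi k (g k) = 1.
Proof. by have [] := greedy_norming (residual_neq0 k infdim). Qed.

Let phi_norming k : norming_functional (g k) (phi k).
Proof. by have [] := fgP k. Qed.

Local Notation s k := `|res k (f k)|.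

Let s_gt0 k : 0 < s k.
Proof. by rewrite normr_gt0 residual_neq0. Qed.

Let phi_le k h : F h -> `|phi k (res k h)| <= s k.
Proof.
move=> Fh; apply: le_trans (norming_functional_le _ (phi_norming k)) _.
by have [_ + _ _] := fgP k; exact.
Qed.

(** Supplies a subspace of each dimension, so that the supremum defining [gamma] is over a nonempty
    family. *)
Lemma has_dim_greedy n : has_dim (lspan (range (fun i : 'I_n => g i))) n.
Proof.
exists (fun i : 'I_n => g i); split=> // a a0 i.
by rewrite -(greedy_coef a i (fun k _ => phi1 k)) a0 residual0 linear0.
Qed.

(* The matrix expressing the [f k] in the basis [s j *: g j] is lower
   unitriangular with entries at most 1, hence the rows of its inverse have
   l1-norm at most [2 ^ k]. *)
Lemma greedy_approx (W : set X) (e : R) : subspace W ->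
  (forall h, F h -> exists2 v, W v & `|h - v| <= e) ->
  forall k, exists2 u, W u & `|s k *: g k - u| <= 2 ^+ k * e.
Proof.
move=> sW We; elim/ltn_ind => k IHk.
have /choice[u_ uP] (j : 'I_k) :
    exists u : X, W u /\ `|s j *: g j - u| <= 2 ^+ j * e.
  by have [u ? ?] := IHk j (ltn_ord j); exists u.
have [Ff _ gE _] := fgP k; have [v Wv fv] := We _ Ff.
(* These are the coefficients of [f k] along [s j *: g j]; the greedy choice of [f j] makes them at
   most 1 in absolute value. *)
pose l (j : 'I_k) := phi j (res j (f k)) / s j.
exists (v - \sum_(j < k) l j *: u_ j).
  apply: subspaceB => //; apply: subspace_sum => // j; exact: (uP j).1.
have -> : s k *: g k - (v - \sum_(j < k) l j *: u_ j) =
    (f k - v) - \sum_(j < k) l j *: (s j *: g j - u_ j).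
  rewrite gE scalerA mulfV ?gt_eqF // scale1r residual_sum.
  under [in RHS]eq_bigr do rewrite scalerBr scalerA divfK ?gt_eqF //.
  by rewrite sumrB opprD addrACA -opprD.
have -> : 2 ^+ k * e = e + \sum_(j < k) 2 ^+ j * e.
  by rewrite -mulr_suml sum_pow2; ring.
apply: le_trans (ler_normB _ _) _; apply: lerD => //.
apply: le_trans (ler_norm_sum _ _ _) _; apply: ler_sum => j _.
rewrite normrZ -[leRHS]mul1r; apply: ler_pM => //; last exact: (uP j).2.
by rewrite normrM normfV normr_id ler_pdivrMr // mul1r phi_le.
Qed.

(** Keeping [B] abstract treats the smoothness bound and the basis constant bound at once. *)
Lemma greedy_residual_le (W : set X) n (e B : R) : has_dim W n -> 0 <= e -> 0 < B ->
  (forall h, F h -> exists2 v, W v & `|h - v| <= e) ->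
  (forall j (a : nat -> R), (j <= n)%N ->
     `|res j (\sum_(i < n.+1) a i *: g i)| <= B * `|\sum_(i < n.+1) a i *: g i|) ->
  exists2 j, (j <= n)%N & s j <= B * 2 ^+ n.+1 * e.
Proof.
move=> dimW e0 B0 We resB; have sW := has_dim_subspace dimW.
have /choice[u uP] k : exists u : X, W u /\ `|s k *: g k - u| <= 2 ^+ k * e.
  by have [u ? ?] := greedy_approx sW We k; exists u.
have [a [[j0 j0n aj0] au0]] := has_dim_dependent dimW (fun j _ => (uP j).1).
have [//|small] := pselect (exists2 j, (j <= n)%N & s j <= B * 2 ^+ n.+1 * e).
have large j : (j <= n)%N -> B * 2 ^+ n.+1 * e <= s j.
  move=> jn; rewrite leNgt; apply/negP => sj.
  by apply: small; exists j => //; exact: ltW.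
pose b k := a k * s k; pose w := \sum_(i < n.+1) b i *: g i.
have b_le j : (j <= n)%N -> `|b j| <= B * `|w|.
  move=> jn; have j_lt : (j < n.+1)%N by [].
  have <- := greedy_coef (fun i => b i) (Ordinal j_lt) (fun k _ => phi1 k).
  apply: le_trans (norming_functional_le _ (phi_norming _)) _; exact: resB.
have w0 : 0 < `|w|.
  rewrite -(pmulr_rgt0 _ B0); apply: lt_le_trans (b_le _ j0n).
  by rewrite normr_gt0 mulf_neq0 // gt_eqF.
have a_le j : (j <= n)%N -> `|a j| * (2 ^+ n.+1 * e) <= `|w|.
  move=> jn; rewrite -(ler_pM2l B0); apply: le_trans (b_le _ jn).
  have -> : B * (`|a j| * (2 ^+ n.+1 * e)) = `|a j| * (B * 2 ^+ n.+1 * e) by ring.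
  by rewrite normrM normr_id ler_wpM2l // large.
(* This contradicts [w0]. Multiplying by [2 ^+ n.+1] instead of dividing by [e] covers [e = 0]. *)
have : 2 ^+ n.+1 * `|w| <= (2 ^+ n.+1 - 1) * `|w|.
  rewrite -sum_pow2 mulr_suml.
  (* The approximants may be subtracted freely, since [a] is a relation among them. *)
  have wE : w = \sum_(i < n.+1) a i *: (s i *: g i - u i).
    under [RHS]eq_bigr do rewrite scalerBr scalerA.
    by rewrite sumrB au0 subr0.
  rewrite {1}wE; apply: le_trans (ler_wpM2l _ (ler_norm_sum _ _ _)) _.
    exact: exprn_ge0.
  rewrite mulr_sumr; apply: ler_sum => i _; rewrite normrZ.
  have i_le : (i <= n)%N by rewrite -ltnS.
  apply: le_trans (_ : 2 ^+ n.+1 * (`|a i| * (2 ^+ i * e)) <= _).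
    by rewrite ler_wpM2l ?exprn_ge0 // ler_wpM2l //; exact: (uP i).2.
  have -> : 2 ^+ n.+1 * (`|a i| * (2 ^+ i * e)) = 2 ^+ i * (`|a i| * (2 ^+ n.+1 * e)).
    by ring.
  by rewrite ler_wpM2l ?exprn_ge0 // a_le.
by rewrite ler_pM2r // lerBrDr gerDl ler10.
Qed.

Lemma partial_sum_norm_ge0 n : (0 <= partial_sum_norm g n)%E.
Proof.
apply: ereal_sup_ubound; exists 0%N, (fun=> 0); rewrite !big_ord0 normr0.
by split.
Qed.

Lemma partial_sum_le (c : R) N (a : nat -> R) j : 0 <= c -> basis_constant g = c%:E ->
  `|\sum_(i < N | (i < j)%N) a i *: g i| <= c * `|\sum_(i < N) a i *: g i|.
Proof.
(* The empty partial sum is separate because [basis_constant] only ranges over positive indices. *)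
move=> c0 gc; case: j => [|j]; first by rewrite big_pred0 // normr0 mulr_ge0.
set w := \sum_(i < N) a i *: g i.
have [w0|w0] := eqVneq w 0.
  rewrite w0 normr0 mulr0 big1 ?normr0 // => i _.
  rewrite -(greedy_coef (fun i => a i) i (fun k _ => phi1 k)) -/w w0.
  by rewrite residual0 linear0 scale0r.
have nw : 0 < `|w| by rewrite normr_gt0.
rewrite -ler_pdivrMr // -lee_fin -gc.
apply: (@le_trans _ _ (partial_sum_norm g j.+1)); last first.
  by apply: ereal_sup_ubound; exists j.+1.
apply: ereal_sup_ubound; exists N, (fun k => `|w|^-1 * a k).
have scale (P : pred 'I_N) : `|\sum_(i < N | P i) (`|w|^-1 * a i) *: g i| =
    `|\sum_(i < N | P i) a i *: g i| / `|w|.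
  under eq_bigr do rewrite -scalerA.
  by rewrite -scaler_sumr normrZ normfV normr_id mulrC.
by rewrite !scale divff ?gt_eqF.
Qed.

(** One bound iterates [greedy_step_le], with [Rconst X >= 1] raising the exponent from [j] to
    [n.+1]. The other holds because on the span of the [g i] the operator [res j] is the identity
    minus a partial sum projection. If the basis constant is infinite, the minimum is the first
    bound. *)
Lemma Bg_residual n : exists B : R, [/\ Bg g n.+1%:R = B%:E, 0 < B &
  forall j (a : nat -> R), (j <= n)%N ->
     `|res j (\sum_(i < n.+1) a i *: g i)| <= B * `|\sum_(i < n.+1) a i *: g i|].
Proof.
have R1 := Rconst_ge1 (g1 0%N); have R0 : 0 <= Rconst X by exact: le_trans R1.
have bound_R j x : (j <= n)%N -> `|res j x| <= Rconst X ^+ n.+1 * `|x|.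
  move=> jn; apply: le_trans (residual_le j x g1 phi_norming) _.
  by rewrite ler_wpM2r // ler_weXn2l // leqW.
have C0 : (0 <= basis_constant g)%E.
  by apply: le_trans (partial_sum_norm_ge0 1) _; apply: ereal_sup_ubound; exists 1%N.
rewrite /Bg powR_mulrn //; case C : (basis_constant g) C0 => [c| |] // c0.
- rewrite lee_fin in c0.
  exists (Order.min (Rconst X ^+ n.+1) (c + 1)); split.
  + by rewrite -EFinD -EFin_min.
  + by rewrite lt_min exprn_gt0 ?(lt_le_trans _ R1) //=; lra.
  move=> j a jn; set w := \sum_(i < n.+1) _.
  rewrite minr_pMl // le_min bound_R //=.
  have -> : res j w = w - \sum_(i < n.+1 | (i < j)%N) a i *: g i.
    rewrite residual_sum; congr (_ - _).
    rewrite (big_ord_widen_cond n.+1 predT (fun i => phi i (res i w) *: g i)) ?leqW //.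
    apply: eq_bigr => i _.
    by rewrite (greedy_coef (fun i => a i) i (fun k _ => phi1 k)).
  apply: le_trans (ler_normB _ _) _; rewrite mulrDl mul1r addrC lerD2r.
  exact: partial_sum_le.
- exists (Rconst X ^+ n.+1); split.
  + by rewrite addye // miney.
  + by rewrite exprn_gt0 // (lt_le_trans _ R1).
  + by move=> j a jn; exact: bound_R.
Qed.

End natural_greedy_algorithm.

(** * Lower bound for the Banach-Mazur factor *)

Section banach_mazur.
Context {R : realType} {X : normedModType R}.

Lemma l2normZ n (c : R) (y : 'rV[R]_n) : l2norm (c *: y) = `|c| * l2norm y.
Proof.
rewrite /l2norm -sqrtr_sqr -sqrtrM ?sqr_ge0 // mulr_sumr.
by congr Num.sqrt; apply: eq_bigr => i _; rewrite mxE exprMn.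
Qed.

Lemma l2norm_gt0 n (y : 'rV[R]_n) : y != 0 -> 0 < l2norm y.
Proof.
move=> /rV0Pn[i yi]; rewrite sqrtr_gt0 (bigD1 i) //=.
by rewrite ltr_wpDr ?exprn_even_gt0 //; apply: sumr_ge0 => j _; exact: sqr_ge0.
Qed.

(** Let [x] be a unit vector of [V] and [t] the Euclidean norm of [T x]. Then [T] has norm at least
    [t], and its inverse sends the unit vector [t^-1 *: T x] to a vector of norm [t^-1]. *)
Lemma gamma_ge1 n (V : set X) : has_dim V n.+1 -> (1 <= gamma X n.+1)%E.
Proof.
move=> dimV; have sV := has_dim_subspace dimV.
apply: (@le_trans _ _
  (banach_mazur (fun x : X => `|x|) (@l2norm R n.+1) V setT)); last first.
  by apply: ereal_sup_ubound; exists V.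
have [x Vx x1] : exists2 x, V x & `|x| = 1.
  have [b [bfree Vb]] := dimV.
  have b0 : b ord0 != 0.
    apply/eqP => b0.
    have := bfree (fun i => (i == ord0)%:R) _ ord0; rewrite eqxx => /(_ _)/eqP.
    rewrite oner_eq0 => /(_ _)/negP; apply => //.
    rewrite (bigD1 ord0) //= b0 scaler0 add0r big1 // => i /negPf ->.
    by rewrite scale0r.
  exists (`|b ord0|^-1 *: b ord0).
    by apply: subspaceZ => //; rewrite Vb; apply: subset_lspan; exists ord0.
  by rewrite normrZ normfV normr_id mulVf ?normr_eq0.
apply: le_ereal_inf_tmp => _ [T [S [[Tlin _ _ ST _] ->]]].
have T0 : T 0 = 0.
  have V0 := sV.1; have := Tlin (- 1) 0 0 V0 V0.
  by rewrite scaler0 addr0 scaleN1r addNr.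
have Tx0 : T x != 0.
  apply/eqP => Tx0; have := ST _ Vx; rewrite Tx0 -T0 (ST _ sV.1) => x0.
  by move: x1; rewrite -x0 normr0 => /eqP; rewrite eq_sym oner_eq0.
have t0 := l2norm_gt0 Tx0; set t := l2norm (T x) in t0.
have -> : 1%E = (t%:E * t^-1%:E)%E by rewrite -EFinM divff // gt_eqF.
apply: lee_pmul; rewrite ?lee_fin ?invr_ge0 ?(ltW t0) //.
  by apply: ereal_sup_ubound; exists x => //; split; rewrite ?x1.
apply: ereal_sup_ubound; exists (t^-1 *: T x).
  by split=> //; rewrite l2normZ ger0_norm ?invr_ge0 ?(ltW t0) // mulVf ?gt_eqF.
have -> : t^-1 *: T x = T (t^-1 *: x).
  by have := Tlin t^-1 x 0 Vx sV.1; rewrite T0 !addr0.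
rewrite ST; last exact: subspaceZ.
by rewrite normrZ x1 mulr1 ger0_norm // invr_ge0 ltW.
Qed.

End banach_mazur.

(** * Passage to the infimum and the final estimate *)

Lemma lee_mul_approx {R : realType} (K : R) (x d : \bar R) : 0 < K -> (0 <= d)%E ->
  (forall e : R, (d < e%:E)%E -> (x <= (K * e)%:E)%E) -> (x <= K%:E * d)%E.
Proof.
move=> K0; case: d => [d| |] //= _ xle; last by rewrite gt0_muley ?lte_fin // leey.
apply/lee_addgt0Pr => e e0.
have -> : (K%:E * d%:E + e%:E)%E = (K * (d + e / K))%:E.
  by rewrite -EFinM -EFinD mulrDr mulrCA divff ?gt_eqF // mulr1.
by apply: xle; rewrite lte_fin ltrDl divr_gt0.
Qed.

Theorem theorem3p5 (R : realType) (X : completeNormedModType R) (F : set X)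
  (F_compact : compact F)
  (F_ball : forall x, F x -> `|x| <= 1)
  (F_infinite_dim : ~ finite_dim (lspan F))
  (f g : nat -> X) (phi : nat -> {scalar X})
  (fgP : NGA_realization F f g phi) (n : nat) :
  (greedy_sigma F f n <=
     Bg g (n.+1)%:R * gamma X (2 * n + 1)%N * (2 ^+ n.+1)%:E *
     kolmogorov_width F n)%E.
Proof.
have [B [-> B0 resB]] := Bg_residual fgP F_infinite_dim n.
have dist_ge0 x (V : set X) : (0 <= dist x V)%E.
  by apply: le_ereal_inf_tmp => _ [v _ <-]; rewrite lee_fin.
have sup_dist_ge0 V : (0 <= sup_dist F V)%E.
  have [Ff _ _ _] := fgP 0%N.
  by apply: le_trans (dist_ge0 (f 0%N) V) _; apply: ereal_sup_ubound; exists (f 0%N).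
have width_ge0 : (0 <= kolmogorov_width F n)%E.
  by apply: le_ereal_inf_tmp => _ [V _ <-].
have gamma1 : (1 <= gamma X (2 * n + 1)%N)%E.
  by rewrite addn1; exact: gamma_ge1 (has_dim_greedy fgP F_infinite_dim _).
apply: (@le_trans _ _ ((B * 2 ^+ n.+1)%:E * kolmogorov_width F n)%E); last first.
  rewrite EFinM lee_wpmul2r // lee_wpmul2r ?lee_fin ?exprn_ge0 //.
  by rewrite -[leLHS]mule1 lee_wpmul2l // lee_fin ltW.
(* The infimum defining the width need not be attained, so the argument runs with an arbitrary real
   [e] above it. *)
apply: lee_mul_approx => // [|e]; first by rewrite mulr_gt0 // exprn_gt0.
move=> width_lt; have [_ [V dimV <-] Ve] := ereal_inf_lt width_lt.
have e0 : 0 <= e by rewrite -lee_fin; exact: le_trans (ltW width_lt).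
have approx h : F h -> exists2 v, V v & `|h - v| <= e.
  move=> Fh; have : (dist h V < e%:E)%E.
    by apply: le_lt_trans Ve; apply: ereal_sup_ubound; exists h.
  by move=> /ereal_inf_lt[_ [v Vv <-]]; rewrite lte_fin => /ltW hv; exists v.
have [j jn sj] := greedy_residual_le fgP F_infinite_dim dimV e0 B0 approx resB.
apply: ge_ereal_sup => _ [h Fh <-].
(* By maximality of [f j], the single small residual at [j] controls all [h] in [F]. *)
apply: le_trans (dist_greedy_space_le fgP h jn) _; rewrite lee_fin.
by apply: le_trans sj; have [_ + _ _] := fgP j; exact.
Qed.
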